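(* Let $f:[a,b]\times\mathbb{R}\to\mathbb{R}$ be of class $C^\infty$, let $u\in C^\infty[a,b]$ be a solution of $u'(t)=f(t,u(t))$, fix $t_i\in[a,b)$ and write $u_i=u(t_i)$, $u_i''=u''(t_i)=f_t+f_uf$; all derivatives of $f$ below are evaluated at $(t_i,u_i)$. Consider the four-stage MQ-RBF-based RK4 method in either of the following two cases. C1: $a_{21}=c_2=\frac25$, $a_{31}=-\frac3{20}$, $a_{32}=\frac34$, $a_{41}=\frac{19}{44}$, $a_{42}=-\frac{15}{44}$, $a_{43}=\frac{10}{11}$, $c_3=\frac35$, $c_4=1$, $w_1=w_4=\frac{11}{72}$, $w_2=w_3=\frac{25}{72}$, with $\varepsilon_{3i}^2=-\frac23\varepsilon_{2i}^2$, $\varepsilon_{4i}^2=\frac2{11}\varepsilon_{2i}^2$, and $$\alpha=168f_{uu}u_i^2,$$ $$\beta=(66f_{ttu}+66f_{uuu}f^2+132f_{tuu}f-462f_{tu}f_u-270f_{uu}f_t-732f_{uu}f_uf+330f_u^3)u_i+132f^2f_{uu}-402f_u^2f+132f_{tu}f-270f_tf_u,$$ $$\begin{aligned}\gamma={}&11(f_{tttt}+f_{uuuu}f^4+4f_{tttu}f+4f_{tuuu}f^3+6f_{ttuu}f^2)-44(f_{ttt}f_u+3f_{ttu}f_uf+3f_uf_{tuu}f^2+f_uf_{uuu}f^3)\\&+330f_tf_{tu}f_u+330f_{tu}f_u^2f+135f_t^2f_{uu}+600f_tf_uf_{uu}f+465f_u^2f_{uu}f^2-330f_u^3u_i''.\end{aligned}$$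 C2: $a_{21}=c_2=\frac14$, $a_{31}=-\frac6{25}$, $a_{32}=\frac{21}{25}$, $a_{41}=\frac65$, $a_{42}=-\frac{57}{35}$, $a_{43}=\frac{10}7$, $c_3=\frac35$, $c_4=1$, $w_1=\frac19$, $w_2=\frac{16}{63}$, $w_3=\frac{125}{252}$, $w_4=\frac5{36}$, with $\varepsilon_{3i}^2=-\frac16\varepsilon_{2i}^2$, $\varepsilon_{4i}^2=\frac1{10}\varepsilon_{2i}^2$, and $$\alpha=3f_{uu}u_i^2,$$ $$\beta=6(f_{ttu}+f^2f_{uuu}+2f_{tuu}f-7f_{tu}f_u-7f_{uu}f_uf+5f_u^3)u_i+12(f_{uu}f^2-f_u^2f+f_{tu}f),$$ $$\begin{aligned}\gamma={}&f_{tttt}+4f_{tttu}f+6f_{ttuu}f^2+4f_{tuuu}f^3+f_{uuuu}f^4-4(f_{ttt}+3f_{ttu}f+3f_{tuu}f^2+f_{uuu}f^3)f_u\\&+18f_{tt}f_{tu}+18f_{tt}f_{uu}f+18f_{uu}^2f^3+36f_{tu}^2f+54f_{tu}f_{uu}f^2+30f_{uu}f_u^2f^2+48f_{uu}f_tf_uf\\&+48f_{tu}f_tf_u+12f_{tu}f_u^2f-18f_{tt}f_u^2-48f_u^3u_i''.\end{aligned}$$ In each case, if $\varepsilon_{2i}^2$ is a real solution $x$ of $\alpha x^2+\beta x+\gamma=0$, then the method is fifth-order accurate, i.e. its local truncation error satisfies $\tau_i=\mathcal{O}(h^5)$ as $h\to0^+$. Moreover, for any real value of $\varepsilon_{2i}^2$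 (in particular if the equation has no real root), the method is still fourth-order accurate, i.e. $\tau_i=\mathcal{O}(h^4)$.
   Context: The MQ-RBF-based RK4 method with step size $h>0$ for $u'=f(t,u)$ takes $\mathbf{u}_i$ to $\mathbf{u}_{i+1}=\mathbf{u}_i+h[w_1K_1+w_2K_2+w_3K_3+w_4K_4]$, where $$K_1=f(t_i,\mathbf{u}_i),\qquad K_2=f\Big(t_i+c_2h,\ \Big(1+\tfrac{\varepsilon_{2i}^2(c_2h)^2}{2}\Big)\big(\mathbf{u}_i+ha_{21}K_1\big)\Big),$$ $$K_3=f\Big(t_i+c_3h,\ \Big(1+\tfrac{\varepsilon_{3i}^2(c_3h)^2}{2}\Big)\big(\mathbf{u}_i+h(a_{31}K_1+a_{32}K_2)\big)\Big),$$ $$K_4=f\Big(t_i+c_4h,\ \Big(1+\tfrac{\varepsilon_{4i}^2(c_4h)^2}{2}\Big)\big(\mathbf{u}_i+h(a_{41}K_1+a_{42}K_2+a_{43}K_3)\big)\Big).$$ The quantities $\varepsilon_{2i}^2,\varepsilon_{3i}^2,\varepsilon_{4i}^2$ are treated as real parameters, which may be negative. The local truncation error at $t_i$ is $$\tau_i=\frac{u(t_i+h)-u(t_i)}{h}-(w_1K_1+w_2K_2+w_3K_3+w_4K_4),$$ with the $K_j$ computed by the formulas above starting from the exact value $\mathbf{u}_i=u(t_i)$. Order $p$ means $\tau_i=\mathcal{O}(h^p)$ as $h\to0^+$, where $t_i$ and the values $\varepsilon_{2i}^2,\varepsilon_{3i}^2,\varepsilon_{4i}^2$ are held fixed. *)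

(* Defs.v *)
(* Classical reals of the Stdlib with Coquelicot. *)
From Stdlib Require Import Reals.
From Coquelicot Require Import Coquelicot.
Open Scope R_scope.

Definition Icc (a b t : R) : Prop := a <= t <= b.

(* Derivatives relative to [a,b]: two-sided at interior points, one-sided at
   the endpoints.  Coquelicot's [is_derive] is the same filterdiff taken along
   the unrestricted filter [locally t]. *)
Definition is_derive_in (a b : R) (g : R -> R) (t l : R) : Prop :=
  filterdiff g (within (Icc a b) (locally t)) (fun y => scal y l).

Definition ex_derive_in (a b : R) (g : R -> R) (t : R) : Prop :=
  exists l, is_derive_in a b g t l.

Definition Derive_in (a b : R) (g : R -> R) (t : R) : R :=
  iota (fun l => is_derive_in a b g t l).

Fixpoint Derive_in_n (a b : R) (n : nat) (g : R -> R) : R -> R :=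
  match n with
  | O => g
  | S k => Derive_in a b (Derive_in_n a b k g)
  end.

(* g is of class C^oo on [a,b]. *)
Definition smooth_in (a b : R) (g : R -> R) : Prop :=
  forall (n : nat) (t : R), Icc a b t -> ex_derive_in a b (Derive_in_n a b n g) t.

(* A function on [a,b] x R is a total function of (t,x) whose values for t
   outside [a,b] are irrelevant; t-derivatives are relative to [a,b]. *)
Definition Dt (a b : R) (f : R -> R -> R) : R -> R -> R :=
  fun t x => Derive_in a b (fun s => f s x) t.

Definition Du (f : R -> R -> R) : R -> R -> R :=
  fun t x => Derive (fun y => f t y) x.

(* f is of class C^n on [a,b] x R: the partial derivatives of order at most n,
   taken in any order of the variables, exist and are jointly continuous. *)
Fixpoint Cn_strip (a b : R) (n : nat) (f : R -> R -> R) : Prop :=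
  continuous_on (fun p : R * R => Icc a b (fst p))
                (fun p : R * R => f (fst p) (snd p)) /\
  match n with
  | O => True
  | S k =>
      (forall t x, Icc a b t ->
         ex_derive_in a b (fun s => f s x) t /\ ex_derive (fun y => f t y) x) /\
      Cn_strip a b k (Dt a b f) /\ Cn_strip a b k (Du f)
  end.

Definition smooth_strip (a b : R) (f : R -> R -> R) : Prop :=
  forall n : nat, Cn_strip a b n f.

(* pd a b f i j differentiates i times in t, then j times in u. *)
Definition pd (a b : R) (f : R -> R -> R) (i j : nat) : R -> R -> R :=
  Nat.iter j Du (Nat.iter i (Dt a b) f).

Record rk4_coeffs := RK4Coeffs {
  c2 : R; c3 : R; c4 : R;
  a21 : R;
  a31 : R; a32 : R;
  a41 : R; a42 : R; a43 : R;
  w1 : R; w2 : R; w3 : R; w4 : R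
}.

(* The multiquadric factor; e stands for the shape parameter eps^2, which may
   be negative, and d for the abscissa increment c_j h. *)
Definition mq_factor (e d : R) : R := 1 + e * d ^ 2 / 2.

Definition mq_rk4_increment (M : rk4_coeffs) (f : R -> R -> R)
    (e2 e3 e4 ti ui h : R) : R :=
  let K1 := f ti ui in
  let K2 := f (ti + c2 M * h)
              (mq_factor e2 (c2 M * h) * (ui + h * a21 M * K1)) in
  let K3 := f (ti + c3 M * h)
              (mq_factor e3 (c3 M * h) *
               (ui + h * (a31 M * K1 + a32 M * K2))) in
  let K4 := f (ti + c4 M * h)
              (mq_factor e4 (c4 M * h) *
               (ui + h * (a41 M * K1 + a42 M * K2 + a43 M * K3))) in
  w1 M * K1 + w2 M * K2 + w3 M * K3 + w4 M * K4.

Definition truncation_error (M : rk4_coeffs) (f : R -> R -> R) (u : R -> R)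
    (e2 e3 e4 ti h : R) : R :=
  (u (ti + h) - u ti) / h - mq_rk4_increment M f e2 e3 e4 ti (u ti) h.

(* tau(h) = O(h^p) as h -> 0+. *)
Definition bigO_pow_right (tau : R -> R) (p : nat) : Prop :=
  exists C : R, at_right 0 (fun h => Rabs (tau h) <= C * h ^ p).

Definition tableau_C1 : rk4_coeffs := {|
  c2 := 2/5; c3 := 3/5; c4 := 1;
  a21 := 2/5;
  a31 := - (3/20); a32 := 3/4;
  a41 := 19/44; a42 := - (15/44); a43 := 10/11;
  w1 := 11/72; w2 := 25/72; w3 := 25/72; w4 := 11/72
|}.

Definition tableau_C2 : rk4_coeffs := {|
  c2 := 1/4; c3 := 3/5; c4 := 1;
  a21 := 1/4;
  a31 := - (6/25); a32 := 21/25;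
  a41 := 6/5; a42 := - (57/35); a43 := 10/7;
  w1 := 1/9; w2 := 16/63; w3 := 125/252; w4 := 5/36
|}.

(* In the next two definitions d i j is the value at (t_i, u_i) of the partial
   derivative of f of order i in t and j in u, ui = u(t_i), ui2 = u''(t_i). *)
Definition quadratic_C1 (d : nat -> nat -> R) (ui ui2 x : R) : R :=
  let f := d 0%nat 0%nat in
  let f_t := d 1%nat 0%nat in
  let f_u := d 0%nat 1%nat in
  let f_tu := d 1%nat 1%nat in
  let f_uu := d 0%nat 2%nat in
  let f_ttt := d 3%nat 0%nat in
  let f_ttu := d 2%nat 1%nat in
  let f_tuu := d 1%nat 2%nat in
  let f_uuu := d 0%nat 3%nat in
  let f_tttt := d 4%nat 0%nat in
  let f_tttu := d 3%nat 1%nat in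
  let f_ttuu := d 2%nat 2%nat in
  let f_tuuu := d 1%nat 3%nat in
  let f_uuuu := d 0%nat 4%nat in
  let alpha := 168 * f_uu * ui ^ 2 in
  let beta :=
    (66 * f_ttu + 66 * f_uuu * f ^ 2 + 132 * f_tuu * f - 462 * f_tu * f_u
     - 270 * f_uu * f_t - 732 * f_uu * f_u * f + 330 * f_u ^ 3) * ui
    + 132 * f ^ 2 * f_uu - 402 * f_u ^ 2 * f + 132 * f_tu * f
    - 270 * f_t * f_u in
  let gamma :=
    11 * (f_tttt + f_uuuu * f ^ 4 + 4 * f_tttu * f + 4 * f_tuuu * f ^ 3
          + 6 * f_ttuu * f ^ 2)
    - 44 * (f_ttt * f_u + 3 * f_ttu * f_u * f + 3 * f_u * f_tuu * f ^ 2
            + f_u * f_uuu * f ^ 3)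
    + 330 * f_t * f_tu * f_u + 330 * f_tu * f_u ^ 2 * f
    + 135 * f_t ^ 2 * f_uu + 600 * f_t * f_u * f_uu * f
    + 465 * f_u ^ 2 * f_uu * f ^ 2 - 330 * f_u ^ 3 * ui2 in
  alpha * x ^ 2 + beta * x + gamma.

Definition quadratic_C2 (d : nat -> nat -> R) (ui ui2 x : R) : R :=
  let f := d 0%nat 0%nat in
  let f_t := d 1%nat 0%nat in
  let f_u := d 0%nat 1%nat in
  let f_tt := d 2%nat 0%nat in
  let f_tu := d 1%nat 1%nat in
  let f_uu := d 0%nat 2%nat in
  let f_ttt := d 3%nat 0%nat in
  let f_ttu := d 2%nat 1%nat in
  let f_tuu := d 1%nat 2%nat in
  let f_uuu := d 0%nat 3%nat in
  let f_tttt := d 4%nat 0%nat in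
  let f_tttu := d 3%nat 1%nat in
  let f_ttuu := d 2%nat 2%nat in
  let f_tuuu := d 1%nat 3%nat in
  let f_uuuu := d 0%nat 4%nat in
  let alpha := 3 * f_uu * ui ^ 2 in
  let beta :=
    6 * (f_ttu + f ^ 2 * f_uuu + 2 * f_tuu * f - 7 * f_tu * f_u
         - 7 * f_uu * f_u * f + 5 * f_u ^ 3) * ui
    + 12 * (f_uu * f ^ 2 - f_u ^ 2 * f + f_tu * f) in
  let gamma :=
    f_tttt + 4 * f_tttu * f + 6 * f_ttuu * f ^ 2 + 4 * f_tuuu * f ^ 3
    + f_uuuu * f ^ 4
    - 4 * (f_ttt + 3 * f_ttu * f + 3 * f_tuu * f ^ 2 + f_uuu * f ^ 3) * f_u
    + 18 * f_tt * f_tu + 18 * f_tt * f_uu * f + 18 * f_uu ^ 2 * f ^ 3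
    + 36 * f_tu ^ 2 * f + 54 * f_tu * f_uu * f ^ 2
    + 30 * f_uu * f_u ^ 2 * f ^ 2 + 48 * f_uu * f_t * f_u * f
    + 48 * f_tu * f_t * f_u + 12 * f_tu * f_u ^ 2 * f
    - 18 * f_tt * f_u ^ 2 - 48 * f_u ^ 3 * ui2 in
  alpha * x ^ 2 + beta * x + gamma.

(* Main.v *)
(** The truncation error has an expansion in powers of h as h -> 0+, so it suffices
    to compute its first five coefficients.  A value f (ti + c h, u_i + h g(h)) is
    expanded by Taylor's formula first in t, relative to [a,b], and then in u; this
    is the order of differentiation in [pd], so no symmetry of mixed partial
    derivatives is needed.  The Taylor coefficients of u are not computed by
    differentiating f(t, u(t)): uniqueness of expansions applied to u' = f(t, u)
    gives a recursion that determines them.  The coefficients of h^0, ..., h^3 then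
    vanish identically, and that of h^4 is -1/39600 (C1) or -1/5760 (C2) times the
    quadratic in eps_2^2. *)
Require Import Defs.
From Stdlib Require Import Reals Lra Lia Arith.
From Coquelicot Require Import Coquelicot.
Open Scope R_scope.

(** * Derivatives relative to an interval *)

(** [filterdiff] quantifies over every point that the filter converges to. Since t lies in [a,b],
    every set of the filter that is cut down to [a,b] still contains t, so the filter is proper, t
    is its only limit, and a single epsilon estimate is left. *)
Lemma is_derive_in_iff (a b : R) (g : R -> R) (t l : R) :
  Icc a b t ->
  is_derive_in a b g t l <->
  forall eps : posreal, within (Icc a b) (locally t)
    (fun y => Rabs (g y - g t - (y - t) * l) <= eps * Rabs (y - t)).
Proof.
intros Ht; split.
- intros [_ H] eps; apply (H t).
  intros P HP; now apply filter_le_within.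
- intros H; split.
  + exact (is_linear_scal_l (V := R_NormedModule) l).
  + intros x Hx.
    assert (PF : ProperFilter' (within (Icc a b) (locally t))).
    { constructor; [| apply within_filter, locally_filter].
      intros HF; exact (locally_singleton _ _ HF Ht). }
    assert (E : x = t).
    { apply (is_filter_lim_unique (K := R_AbsRing) (V := R_NormedModule)
               (F := within (Icc a b) (locally t)) x t Hx).
      intros P HP; now apply filter_le_within. }
    subst x; exact H.
Qed.

Lemma is_derive_in_subset (a b p q : R) (g : R -> R) (t l : R) :
  a <= p -> q <= b -> Icc p q t ->
  is_derive_in a b g t l -> is_derive_in p q g t l.
Proof.
intros Hp Hq Ht H.
assert (Ht' : Icc a b t) by (unfold Icc in *; lra).
apply is_derive_in_iff; [exact Ht|]; intros eps.
apply (proj1 (is_derive_in_iff a b g t l Ht')) with (eps := eps) in H.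
revert H; unfold within; apply filter_imp; intros y Hy Hy'; apply Hy; unfold Icc in *; lra.
Qed.

Lemma is_derive_is_derive_in (a b : R) (g : R -> R) (t l : R) :
  Icc a b t -> is_derive g t l -> is_derive_in a b g t l.
Proof.
intros Ht [_ H]; apply is_derive_in_iff; [exact Ht|]; intros eps.
apply filter_le_within.
apply (H t); intros P HP; exact HP.
Qed.

(** An interior point has a neighbourhood inside [a,b], so restricting the filter changes nothing
    there. The mean value theorem needs this two-sided form. *)
Lemma is_derive_in_interior (a b : R) (g : R -> R) (t l : R) :
  a < t < b -> is_derive_in a b g t l -> is_derive g t l.
Proof.
intros Ht H.
assert (Ht' : Icc a b t) by (unfold Icc; lra).
destruct (is_derive_in_iff a b g t l Ht') as [Hiff _]; specialize (Hiff H); clear H.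
split; [exact (is_linear_scal_l (V := R_NormedModule) l)|].
intros x Hx.
apply (is_filter_lim_locally_unique (V := R_NormedModule)) in Hx; subst x.
intros eps; assert (H := Hiff eps).
assert (Hab : locally t (Icc a b)).
{ assert (H1 : locally t (fun y => a < y)) by now apply open_gt.
  assert (H2 : locally t (fun y => y < b)) by now apply open_lt.
  generalize (filter_and _ _ H1 H2); apply filter_imp; unfold Icc; intros; lra. }
unfold within in H; generalize (filter_and (F := locally t) _ _ H Hab); apply filter_imp.
intros y [Hy Hy']; exact (Hy Hy').
Qed.

Lemma is_derive_in_unique (a b : R) (g : R -> R) (t l l' : R) :
  a < b -> Icc a b t ->
  is_derive_in a b g t l -> is_derive_in a b g t l' -> l = l'.
Proof.
intros Hab Ht H H'.
destruct (Req_dec l l') as [E | E]; [exact E | exfalso].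
(* With a quarter of |l - l'| as tolerance, the two estimates add up to |l - l'| |y - t| / 2, which
   is too small for a point y other than t. *)
assert (He : 0 < Rabs (l - l') / 4).
{ assert (0 < Rabs (l - l')) by (apply Rabs_pos_lt; lra); lra. }
set (eps := mkposreal _ He).
apply (proj1 (is_derive_in_iff a b g t l Ht)) with (eps := eps) in H.
apply (proj1 (is_derive_in_iff a b g t l' Ht)) with (eps := eps) in H'.
destruct (filter_and _ _ H H') as [del Hd].
(* The point is taken to the right of t when t < b and to the left otherwise; a < b makes this
   possible. *)
assert (exists y, Icc a b y /\ y <> t /\ Rabs (y - t) < del) as (y & Hy & Hne & Hyt).
{ assert (Hdel := cond_pos del); unfold Icc in *.
  destruct (Rlt_dec t b) as [Htb | Htb].
  - exists (Rmin b (t + del / 2)).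
    assert (t < Rmin b (t + del / 2)) by (apply Rmin_glb_lt; lra).
    assert (H1 := Rmin_l b (t + del / 2)); assert (H2 := Rmin_r b (t + del / 2)).
    split; [lra | split; [lra|]]; rewrite Rabs_pos_eq; lra.
  - exists (Rmax a (t - del / 2)).
    assert (Rmax a (t - del / 2) < t) by (apply Rmax_lub_lt; lra).
    assert (H1 := Rmax_l a (t - del / 2)); assert (H2 := Rmax_r a (t - del / 2)).
    split; [lra | split; [lra|]]; rewrite Rabs_left; lra. }
destruct (Hd y Hyt Hy) as [A B].
unfold eps in A, B; simpl in A, B.
assert (Hp : 0 < Rabs (y - t)) by (apply Rabs_pos_lt; lra).
assert (C : Rabs ((y - t) * (l - l')) <= Rabs (l - l') / 2 * Rabs (y - t)).
{ replace ((y - t) * (l - l')) with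
    ((g y - g t - (y - t) * l') - (g y - g t - (y - t) * l)) by ring.
  eapply Rle_trans; [apply Rabs_triang|]; rewrite Rabs_Ropp; lra. }
rewrite Rabs_mult in C; nra.
Qed.

Lemma Derive_in_correct (a b : R) (g : R -> R) (t : R) :
  a < b -> Icc a b t -> ex_derive_in a b g t ->
  is_derive_in a b g t (Derive_in a b g t).
Proof.
intros Hab Ht [l Hl]; unfold Derive_in.
apply (iota_correct (V := R_CompleteNormedModule)
         (fun l => is_derive_in a b g t l)).
exists l; split; [exact Hl|].
intros l' Hl'; now apply (is_derive_in_unique a b g t).
Qed.

(** * Taylor's formula on a closed interval *)

Definition clamp (p q t : R) : R := Rmax p (Rmin q t).

Lemma clamp_in (p q t : R) : p <= q -> Icc p q (clamp p q t).
Proof.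
unfold clamp, Icc, Rmax, Rmin; intros.
destruct (Rle_dec q t); destruct (Rle_dec p _); lra.
Qed.

Lemma clamp_id (p q t : R) : Icc p q t -> clamp p q t = t.
Proof.
unfold clamp, Icc, Rmax, Rmin; intros.
destruct (Rle_dec q t); destruct (Rle_dec p _); lra.
Qed.

Lemma clamp_lipschitz (p q s t : R) :
  p <= q -> Rabs (clamp p q s - clamp p q t) <= Rabs (s - t).
Proof.
unfold clamp, Icc, Rmax, Rmin; intros.
destruct (Rle_dec q t); destruct (Rle_dec q s); repeat destruct (Rle_dec p _);
  unfold Rabs; repeat destruct (Rcase_abs _); lra.
Qed.

Lemma is_derive_in_filterlim (p q : R) (g : R -> R) (t : R) :
  Icc p q t -> ex_derive_in p q g t ->
  filterlim g (within (Icc p q) (locally t)) (locally (g t)).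
Proof.
intros Ht [l Hl].
apply (filterdiff_continuous_aux (V := R_NormedModule)
         (U := R_NormedModule) (F := within (Icc p q) (locally t))).
- now eexists; exact Hl.
- intros P HP; now apply filter_le_within.
Qed.

(** The mean value theorem asks for two-sided continuity at the endpoints too. Composition with the
    1-Lipschitz retraction [clamp] turns continuity relative to [p,q] into continuity on R. *)
Lemma continuity_pt_clamp (p q : R) (g : R -> R) :
  p <= q -> (forall t, Icc p q t -> ex_derive_in p q g t) ->
  forall t, continuity_pt (fun s => g (clamp p q s)) t.
Proof.
intros Hpq Hg t; apply continuity_pt_filterlim.
eapply filterlim_comp;
  [| apply (is_derive_in_filterlim p q g); [| apply Hg]; now apply clamp_in].
intros P [del Hd]; exists del; intros s Hs.
apply Hd; [| now apply clamp_in].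
eapply Rle_lt_trans; [now apply clamp_lipschitz | exact Hs].
Qed.

(** Unlike [sum_f_R0], this allows the empty sum, so that inductions on the order of an expansion
    can start at n = 0. *)
Fixpoint sum_lt (F : nat -> R) (n : nat) : R :=
  match n with O => 0 | S m => sum_lt F m + F m end.

Lemma sum_lt_ext (F G : nat -> R) (n : nat) :
  (forall k, (k < n)%nat -> F k = G k) -> sum_lt F n = sum_lt G n.
Proof.
induction n as [|n IH]; intros H; simpl; [easy|].
rewrite IH, H; auto with arith.
Qed.

Definition polynomial (c : nat -> R) (n : nat) (h : R) : R :=
  sum_lt (fun k => c k * h ^ k) n.

Lemma polynomial_head (c : nat -> R) (n : nat) (h : R) :
  polynomial c (S n) h = c 0%nat + h * polynomial (fun k => c (S k)) n h.
Proof.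
unfold polynomial; induction n as [|n IH]; simpl in *; [ring|].
rewrite IH; ring.
Qed.

Lemma is_derive_polynomial (c : nat -> R) (n : nat) (x0 x : R) :
  is_derive (fun s => polynomial c (S n) (s - x0)) x
    (polynomial (fun k => INR (S k) * c (S k)) n (x - x0)).
Proof.
induction n as [|n IH].
- unfold polynomial; simpl; auto_derive; [easy | ring].
- change (is_derive (fun s => plus (polynomial c (S n) (s - x0))
                                (c (S n) * (s - x0) ^ (S n))) x
     (plus (polynomial (fun k => INR (S k) * c (S k)) n (x - x0))
         (INR (S n) * c (S n) * (x - x0) ^ n))).
  apply (is_derive_plus (K := R_AbsRing) (V := R_NormedModule)); [exact IH|].
  auto_derive; [easy|].
  change (c (S n) * (1 * (INR (S n) * (x - x0) ^ n))
          = INR (S n) * c (S n) * (x - x0) ^ n); ring.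
Qed.

(** By induction: the remainder vanishes at c and its derivative is the remainder of one order less
    for the shifted family, so the mean value theorem supplies one more factor |t - c|. The factor
    1/n! is given up because only the order matters. A family [G] in place of iterated derivatives
    covers derivatives in t, in u, and of the solution. *)
Lemma taylor_in (p q c M : R) (n : nat) (G : nat -> R -> R) :
  Icc p q c ->
  (forall k t, (k < n)%nat -> Icc p q t -> is_derive_in p q (G k) t (G (S k) t)) ->
  (forall t, Icc p q t -> Rabs (G n t) <= M) ->
  forall t, Icc p q t ->
    Rabs (G 0%nat t - polynomial (fun k => G k c / INR (fact k)) n (t - c))
    <= M * Rabs (t - c) ^ n.
Proof.
intros Hc; revert G; induction n as [|n IH]; intros G HG HM t Ht.
- unfold polynomial; simpl; rewrite Rminus_0_r, Rmult_1_r; now apply HM.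
- set (co := fun k => G k c / INR (fact k)).
  assert (HM0 : 0 <= M) by (eapply Rle_trans; [apply Rabs_pos | now apply (HM c)]).
  assert (Hpq : p <= q) by (unfold Icc in Hc; lra).
  set (dphi := fun s => G 1%nat s -
         polynomial (fun k => INR (S k) * co (S k)) n (s - c)).
  assert (Hbd : forall s, Icc p q s -> Rabs (dphi s) <= M * Rabs (s - c) ^ n).
  { intros s Hs; unfold dphi.
    replace (polynomial (fun k => INR (S k) * co (S k)) n (s - c))
      with (polynomial (fun k => G (S k) c / INR (fact k)) n (s - c)).
    - apply (IH (fun k => G (S k))); auto.
      intros k t' Hk; apply HG; lia.
    - apply sum_lt_ext; intros k _; unfold co; rewrite fact_simpl, mult_INR.
      assert (H1 := INR_fact_neq_0 k); assert (H2 : INR (S k) <> 0) by now apply not_0_INR.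
      field; easy. }
  destruct (MVT_gen
     (fun s => G 0%nat (clamp p q s) - polynomial co (S n) (s - c)) c t dphi)
    as (xi & Hxi & E).
  + intros s Hs.
    assert (Hs' : p < s < q).
    { unfold Icc in *; revert Hs; unfold Rmin, Rmax.
      destruct (Rle_dec c t); lra. }
    apply (is_derive_minus (K := R_AbsRing) (V := R_NormedModule));
      [| apply is_derive_polynomial].
    apply is_derive_ext_loc with (G 0%nat).
    * assert (H1 : locally s (fun y => p < y)) by now apply open_gt.
      assert (H2 : locally s (fun y => y < q)) by now apply open_lt.
      generalize (filter_and _ _ H1 H2); apply filter_imp.
      intros y Hy; rewrite clamp_id; [easy | unfold Icc; lra].
    * apply (is_derive_in_interior p q); [exact Hs'|].
      apply HG; [lia | unfold Icc; lra].
  + intros s _.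
    apply (continuity_pt_minus (fun s => G 0%nat (clamp p q s))
             (fun s => polynomial co (S n) (s - c))).
    * apply continuity_pt_clamp; [exact Hpq|].
      intros s' Hs'; eexists; apply HG; [lia | exact Hs'].
    * apply derivable_continuous_pt.
      eexists; apply is_derive_Reals, is_derive_polynomial.
  + assert (Hxi' : Icc p q xi /\ Rabs (xi - c) <= Rabs (t - c)).
    { unfold Icc in *; revert Hxi; unfold Rmin, Rmax, Rabs.
      destruct (Rle_dec c t); repeat destruct (Rcase_abs _); lra. }
    destruct Hxi' as [Hi Hle].
    rewrite (clamp_id p q t), (clamp_id p q c) in E by assumption.
    assert (E0 : polynomial co (S n) (c - c) = G 0%nat c).
    { rewrite polynomial_head; unfold co at 1; change (INR (fact 0)) with 1; field. }
    rewrite E0 in E.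
    replace (G 0%nat t - polynomial co (S n) (t - c)) with (dphi xi * (t - c)) by lra.
    rewrite Rabs_mult; simpl pow.
    apply Rle_trans with (M * Rabs (t - c) ^ n * Rabs (t - c)); [|lra].
    apply Rmult_le_compat_r; [apply Rabs_pos|].
    eapply Rle_trans; [now apply Hbd|].
    apply Rmult_le_compat_l; [exact HM0|].
    apply pow_incr; split; [apply Rabs_pos | exact Hle].
Qed.

(** * Expansions at 0+ *)

Lemma sum_lt_head (F : nat -> R) (n : nat) :
  sum_lt F (S n) = F 0%nat + sum_lt (fun k => F (S k)) n.
Proof.
induction n as [|n IH]; simpl in *; [ring|].
rewrite IH; ring.
Qed.

Lemma sum_f_R0_head (F : nat -> R) (n : nat) :
  sum_f_R0 F (S n) = F 0%nat + sum_f_R0 (fun k => F (S k)) n.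
Proof. now rewrite decomp_sum by lia. Qed.

Lemma at_right_0_lt (del : R) : 0 < del -> at_right 0 (fun h => 0 < h < del).
Proof.
intros Hd; exists (mkposreal del Hd); intros h Hh H0.
assert (H : Rabs (h - 0) < del) by exact Hh.
rewrite Rminus_0_r, Rabs_pos_eq in H; lra.
Qed.

Lemma bigO_ext_near (p : nat) (g g' : R -> R) :
  at_right 0 (fun h => g h = g' h) -> bigO_pow_right g p -> bigO_pow_right g' p.
Proof.
intros E [C HC]; exists C.
generalize (filter_and _ _ E HC); apply filter_imp.
intros h [Hh Hh']; now rewrite <- Hh.
Qed.

Lemma bigO_plus (p : nat) (g g' : R -> R) :
  bigO_pow_right g p -> bigO_pow_right g' p ->
  bigO_pow_right (fun h => g h + g' h) p.
Proof.
intros [C HC] [C' HC']; exists (C + C').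
generalize (filter_and _ _ HC HC'); apply filter_imp; intros h [H H'].
eapply Rle_trans; [apply Rabs_triang | lra].
Qed.

Lemma bigO_mult (p q : nat) (g g' : R -> R) :
  bigO_pow_right g p -> bigO_pow_right g' q ->
  bigO_pow_right (fun h => g h * g' h) (p + q).
Proof.
intros [C HC] [C' HC']; exists (C * C').
generalize (filter_and _ _ HC HC'); apply filter_imp; intros h [H H'].
rewrite Rabs_mult, pow_add.
replace (C * C' * (h ^ p * h ^ q)) with ((C * h ^ p) * (C' * h ^ q)) by ring.
apply Rmult_le_compat; auto using Rabs_pos.
Qed.

Lemma bigO_const (x : R) : bigO_pow_right (fun _ => x) 0.
Proof.
exists (Rabs x); apply filter_forall; intros h; simpl; lra.
Qed.

Lemma bigO_S (p : nat) (g : R -> R) :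
  bigO_pow_right g (S p) <-> bigO_pow_right (fun h => g h / h) p.
Proof.
split; intros [C HC]; exists C;
  generalize (filter_and _ _ HC (at_right_0_lt 1 Rlt_0_1)); apply filter_imp;
  intros h [H Hh]; unfold Rdiv in *.
- rewrite Rabs_mult, (Rabs_pos_eq (/ h)) by (left; apply Rinv_0_lt_compat; lra).
  apply Rmult_le_reg_r with h; [lra|].
  rewrite Rmult_assoc, Rinv_l, Rmult_1_r by lra; simpl in H; lra.
- rewrite Rabs_mult, (Rabs_pos_eq (/ h)) in H by (left; apply Rinv_0_lt_compat; lra).
  apply (Rmult_le_compat_r h) in H; [|lra].
  rewrite Rmult_assoc, Rinv_l, Rmult_1_r in H by lra; simpl; lra.
Qed.

(** Only coefficients of index below n count, but a whole sequence is kept so that products and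
    powers of expansions are those of formal power series. At n = 0 this is boundedness near 0+. *)
Definition expands (n : nat) (g : R -> R) (c : nat -> R) : Prop :=
  bigO_pow_right (fun h => g h - polynomial c n h) n.

Lemma expands_ext_near (n : nat) (g g' : R -> R) (c : nat -> R) :
  at_right 0 (fun h => g h = g' h) -> expands n g c -> expands n g' c.
Proof.
intros E; apply bigO_ext_near; revert E; apply filter_imp.
now intros h ->.
Qed.

Lemma expands_ext (n : nat) (g g' : R -> R) (c : nat -> R) :
  (forall h, g h = g' h) -> expands n g c -> expands n g' c.
Proof. intros E; apply expands_ext_near; now apply filter_forall. Qed.

Lemma expands_ext_coeff (n : nat) (g : R -> R) (c c' : nat -> R) :
  (forall k, (k < n)%nat -> c k = c' k) -> expands n g c -> expands n g c'.
Proof.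
intros E; apply bigO_ext_near; apply filter_forall; intros h; f_equal.
apply sum_lt_ext; intros k Hk; now rewrite E.
Qed.

(** This is the induction step behind truncation, uniqueness and products of expansions. *)
Lemma expands_S (n : nat) (g : R -> R) (c : nat -> R) :
  expands (S n) g c <->
  expands n (fun h => (g h - c 0%nat) / h) (fun k => c (S k)).
Proof.
assert (E : at_right 0 (fun h => (g h - polynomial c (S n) h) / h =
   (g h - c 0%nat) / h - polynomial (fun k => c (S k)) n h)).
{ generalize (at_right_0_lt 1 Rlt_0_1); apply filter_imp; intros h Hh.
  rewrite polynomial_head; field; lra. }
unfold expands; rewrite bigO_S.
split; apply bigO_ext_near; [exact E|].
revert E; now apply filter_imp.
Qed.

Lemma expands_0 (g : R -> R) (c : nat -> R) :
  expands 0 g c <-> bigO_pow_right g 0.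
Proof.
split; apply bigO_ext_near; apply filter_forall; intros h;
  unfold polynomial; simpl; ring.
Qed.

Lemma expands_const (n : nat) (x : R) :
  expands n (fun _ => x) (fun k => match k with O => x | S _ => 0 end).
Proof.
assert (H0 : forall m, expands m (fun _ => 0) (fun _ => 0)).
{ intros m; exists 0; apply filter_forall; intros h.
  replace (polynomial (fun _ => 0) m h) with 0;
    [rewrite Rminus_0_r, Rabs_R0; lra|].
  unfold polynomial; induction m as [|m IH]; simpl; [easy | rewrite <- IH; ring]. }
destruct n as [|n]; [apply expands_0, bigO_const|].
apply expands_S; apply expands_ext with (2 := H0 n).
intros h; unfold Rdiv; ring.
Qed.

Lemma expands_plus (n : nat) (g g' : R -> R) (c c' : nat -> R) :
  expands n g c -> expands n g' c' ->
  expands n (fun h => g h + g' h) (fun k => c k + c' k).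
Proof.
intros H H'; generalize (bigO_plus _ _ _ H H').
apply bigO_ext_near, filter_forall; intros h.
replace (polynomial (fun k => c k + c' k) n h)
  with (polynomial c n h + polynomial c' n h); [ring|].
unfold polynomial; clear; induction n as [|n IH]; simpl; [ring|].
rewrite <- IH; ring.
Qed.

Lemma expands_scal (n : nat) (x : R) (g : R -> R) (c : nat -> R) :
  expands n g c -> expands n (fun h => x * g h) (fun k => x * c k).
Proof.
intros H; generalize (bigO_mult _ _ _ _ (bigO_const x) H).
apply bigO_ext_near, filter_forall; intros h.
replace (polynomial (fun k => x * c k) n h) with (x * polynomial c n h); [ring|].
unfold polynomial; clear; induction n as [|n IH]; simpl; [ring|].
rewrite <- IH; ring.
Qed.

Lemma expands_shift (n : nat) (g : R -> R) (c : nat -> R) :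
  expands n g c ->
  expands (S n) (fun h => h * g h) (fun k => match k with O => 0 | S k => c k end).
Proof.
intros H; apply expands_S; revert H; apply expands_ext_near.
generalize (at_right_0_lt 1 Rlt_0_1); apply filter_imp; intros h Hh.
field; lra.
Qed.

Lemma expands_pred (n : nat) (g : R -> R) (c : nat -> R) :
  expands (S n) g c -> expands n g c.
Proof.
revert g c; induction n as [|n IH]; intros g c H; apply expands_S in H.
- apply expands_0; apply expands_0 in H.
  destruct H as [C HC]; exists (Rabs (c 0%nat) + C).
  generalize (filter_and _ _ HC (at_right_0_lt 1 Rlt_0_1)); apply filter_imp.
  intros h [H Hh]; simpl in *.
  replace (g h) with (c 0%nat + h * ((g h - c 0%nat) / h)) by (field; lra).
  eapply Rle_trans; [apply Rabs_triang|].
  rewrite Rabs_mult, (Rabs_pos_eq h) by lra.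
  assert (0 <= Rabs ((g h - c 0%nat) / h)) by (apply Rabs_pos); nra.
- apply expands_S, IH, H.
Qed.

Lemma expands_le (n m : nat) (g : R -> R) (c : nat -> R) :
  (n <= m)%nat -> expands m g c -> expands n g c.
Proof. induction 1; [easy | intros H'; now apply IHle, expands_pred]. Qed.

(** Two constant terms can differ by at most a multiple of h, for all small h, so they agree;
    [expands_S] then passes to the next coefficient. *)
Lemma expands_unique (n : nat) (g : R -> R) (c c' : nat -> R) :
  expands n g c -> expands n g c' -> forall k, (k < n)%nat -> c k = c' k.
Proof.
revert g c c'; induction n as [|n IH]; intros g c c' H H' k Hk; [lia|].
assert (E : c 0%nat = c' 0%nat).
{ destruct (Req_dec (c 0%nat) (c' 0%nat)) as [E | E]; [exact E | exfalso].
  destruct (expands_le 1 (S n) g c) as [C HC]; [lia | exact H |].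
  destruct (expands_le 1 (S n) g c') as [C' HC']; [lia | exact H' |].
  set (e := Rabs (c 0%nat - c' 0%nat)).
  assert (He : 0 < e) by (apply Rabs_pos_lt; lra).
  (* [C] and [C'] may be zero or negative; [K] is positive and above C + C', so an h < e / K
     contradicts e <= (C + C') h. *)
  set (K := Rabs C + Rabs C' + 1).
  assert (HK : 0 < K) by (assert (H1 := Rabs_pos C); assert (H2 := Rabs_pos C'); unfold K; lra).
  assert (HeK : 0 < e / K) by (now apply Rdiv_lt_0_compat).
  destruct (filter_ex _ (filter_and _ _ (filter_and _ _ HC HC') (at_right_0_lt _ HeK)))
    as (h & [A B] & Hh0 & Hh1).
  unfold polynomial in A, B; simpl in A, B.
  assert (HhK : h * K < e).
  { apply (Rmult_lt_compat_r K) in Hh1; [|lra].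
    replace (e / K * K) with e in Hh1 by (field; lra); lra. }
  assert (D : e <= (C + C') * h).
  { unfold e; replace (c 0%nat - c' 0%nat) with
      ((g h - (0 + c' 0%nat * 1)) - (g h - (0 + c 0%nat * 1))) by ring.
    eapply Rle_trans; [apply Rabs_triang|]; rewrite Rabs_Ropp; lra. }
  assert (H1 := Rle_abs C); assert (H2 := Rle_abs C'); unfold K in HhK; nra. }
destruct k as [|k]; [exact E|].
apply (proj1 (expands_S _ _ _)) in H; apply (proj1 (expands_S _ _ _)) in H'.
rewrite <- E in H'.
now apply (IH _ _ _ H H'); lia.
Qed.

(** With a = c 0 and a' = c' 0, one has (g g' - a a') / h = ((g - a) / h) g' + a ((g' - a') / h),
    and the Cauchy product obeys the same recursion in its index. *)
Lemma expands_mult (n : nat) (g g' : R -> R) (c c' : nat -> R) :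
  expands n g c -> expands n g' c' ->
  expands n (fun h => g h * g' h) (PS_mult c c').
Proof.
revert g g' c c'; induction n as [|n IH]; intros g g' c c' H H'.
- apply expands_0 in H; apply expands_0 in H'; apply expands_0.
  exact (bigO_mult _ _ _ _ H H').
- assert (H1 := proj1 (expands_S _ _ _) H); assert (H1' := proj1 (expands_S _ _ _) H').
  apply expands_S.
  apply expands_ext_coeff with
    (fun k => PS_mult (fun k => c (S k)) c' k + c 0%nat * c' (S k)).
  { intros k _; unfold PS_mult; rewrite sum_f_R0_head, Nat.sub_0_r; simpl; ring. }
  apply expands_ext with
    (fun h => (g h - c 0%nat) / h * g' h + c 0%nat * ((g' h - c' 0%nat) / h)).
  { intros h; unfold PS_mult, Rdiv; simpl; ring. }
  apply expands_plus; [apply IH; [exact H1 | now apply expands_pred]|].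
  now apply expands_scal.
Qed.

(** * Powers, shifted sums and composition of expansions *)

Fixpoint PS_power (c : nat -> R) (j : nat) : nat -> R :=
  match j with
  | O => fun k => match k with O => 1 | S _ => 0 end
  | S j => PS_mult c (PS_power c j)
  end.

Lemma expands_pow (n : nat) (g : R -> R) (c : nat -> R) (j : nat) :
  expands n g c -> expands n (fun h => g h ^ j) (PS_power c j).
Proof.
intros H; induction j as [|j IH]; simpl.
- apply expands_const.
- now apply expands_mult.
Qed.

(** The factor h^j moves the j-th expansion by j places, so the coefficient of h^k is a diagonal
    sum. The induction splits off j = 0 and takes one factor h out of the rest, which regains the
    order lost on the tail. *)
Lemma expands_sum_shifted (n : nat) (g : nat -> R -> R) (c : nat -> nat -> R) :
  (forall j, (j < n)%nat -> expands n (g j) (c j)) ->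
  expands n (fun h => sum_lt (fun j => h ^ j * g j h) n)
    (fun k => sum_f_R0 (fun j => c j (k - j)%nat) k).
Proof.
revert g c; induction n as [|n IH]; intros g c H.
- apply expands_0; exact (bigO_const 0).
- assert (H1 : expands n (fun h => sum_lt (fun j => h ^ j * g (S j) h) n)
    (fun k => sum_f_R0 (fun j => c (S j) (k - j)%nat) k)).
  { apply (IH (fun j => g (S j)) (fun j => c (S j))).
    intros j Hj; apply expands_pred, H; lia. }
  apply expands_shift in H1.
  assert (H2 := expands_plus _ _ _ _ _ (H 0%nat (Nat.lt_0_succ n)) H1).
  apply expands_ext_coeff with (c' := fun k => sum_f_R0 (fun j => c j (k - j)%nat) k)
    in H2.
  + revert H2; apply expands_ext; intros h; rewrite sum_lt_head; simpl pow.
    rewrite Rmult_1_l; f_equal; clear.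
    induction n as [|n IH]; simpl; [ring | rewrite <- IH; simpl; ring].
  + intros [|k] _; [simpl; ring|].
    now rewrite sum_f_R0_head, Nat.sub_0_r.
Qed.

Lemma expands_bounded (n : nat) (g : R -> R) (c : nat -> R) :
  expands n g c -> exists B, 0 <= B /\ at_right 0 (fun h => Rabs (g h) <= B).
Proof.
intros H; apply (expands_le 0) in H; [|lia].
apply expands_0 in H; destruct H as [C HC]; exists (Rabs C).
split; [apply Rabs_pos|].
revert HC; apply filter_imp; intros h Hh; simpl in Hh.
assert (H := Rle_abs C); lra.
Qed.

Lemma expands_of_taylor (n : nat) (g : R -> R) (e : nat -> R) (M del : R) :
  0 < del ->
  (forall h, 0 <= h <= del -> Rabs (g h - polynomial e n h) <= M * Rabs h ^ n) ->
  expands n g e.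
Proof.
intros Hd H; exists M; generalize (at_right_0_lt _ Hd); apply filter_imp.
intros h Hh; specialize (H h); rewrite (Rabs_pos_eq h) in H by lra.
apply H; lra.
Qed.

(** The increment of the argument is h g(h), so the j-th Taylor term carries h^j and
    [expands_sum_shifted] applies. As g is bounded near 0+, the Taylor remainder is O(h^n). *)
Lemma expands_comp (n : nat) (phi g : R -> R) (e c : nat -> R) (x0 M del : R) :
  0 < del ->
  (forall x, Rabs (x - x0) <= del ->
     Rabs (phi x - polynomial e n (x - x0)) <= M * Rabs (x - x0) ^ n) ->
  expands n g c ->
  expands n (fun h => phi (x0 + h * g h))
    (fun k => sum_f_R0 (fun j => e j * PS_power c j (k - j)) k).
Proof.
intros Hd Hphi Hg.
assert (H1 := expands_sum_shifted n (fun j h => e j * g h ^ j)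
  (fun j k => e j * PS_power c j k)
  (fun j _ => expands_scal _ (e j) _ _ (expands_pow _ _ _ j Hg))).
destruct (expands_bounded _ _ _ Hg) as (B & HB0 & HB).
assert (H2 : bigO_pow_right (fun h => phi (x0 + h * g h) -
   sum_lt (fun j => h ^ j * (e j * g h ^ j)) n) n).
{ exists (Rabs M * B ^ n).
  (* Such h give |h g(h)| <= [del]; adding 1 allows B = 0. *)
  assert (Hr : 0 < del / (B + 1)) by (apply Rdiv_lt_0_compat; lra).
  generalize (filter_and _ _ HB (at_right_0_lt _ Hr)); apply filter_imp.
  intros h (Hh & Hh0 & Hh1).
  assert (Hv : Rabs (h * g h) <= h * B).
  { rewrite Rabs_mult, (Rabs_pos_eq h) by lra; apply Rmult_le_compat_l; lra. }
  assert (Hv' : h * B <= del).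
  { apply (Rmult_lt_compat_r (B + 1)) in Hh1; [|lra].
    replace (del / (B + 1) * (B + 1)) with del in Hh1 by (field; lra); nra. }
  specialize (Hphi (x0 + h * g h)).
  replace (x0 + h * g h - x0) with (h * g h) in Hphi by ring.
  replace (sum_lt (fun j => h ^ j * (e j * g h ^ j)) n)
    with (polynomial e n (h * g h)).
  2:{ apply sum_lt_ext; intros k _; rewrite Rpow_mult_distr; ring. }
  eapply Rle_trans; [apply Hphi; lra|].
  replace (Rabs M * B ^ n * h ^ n) with (Rabs M * (h * B) ^ n)
    by (rewrite Rpow_mult_distr; ring).
  apply Rle_trans with (Rabs M * Rabs (h * g h) ^ n).
  - apply Rmult_le_compat_r; [apply pow_le, Rabs_pos | apply Rle_abs].
  - apply Rmult_le_compat_l; [apply Rabs_pos|].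
    apply pow_incr; split; [apply Rabs_pos | exact Hv]. }
generalize (bigO_plus _ _ _ H2 H1); apply bigO_ext_near, filter_forall.
intros h; ring.
Qed.

(** * Smooth functions on the strip *)

Lemma smooth_strip_Dt (a b : R) (f : R -> R -> R) :
  smooth_strip a b f -> smooth_strip a b (Dt a b f).
Proof. intros H n; exact (proj1 (proj2 (proj2 (H (S n))))). Qed.

Lemma smooth_strip_Du (a b : R) (f : R -> R -> R) :
  smooth_strip a b f -> smooth_strip a b (Du f).
Proof. intros H n; exact (proj2 (proj2 (proj2 (H (S n))))). Qed.

Lemma smooth_strip_Dt_iter (a b : R) (f : R -> R -> R) (i : nat) :
  smooth_strip a b f -> smooth_strip a b (Nat.iter i (Dt a b) f).
Proof. intros H; induction i as [|i IH]; [exact H | now apply smooth_strip_Dt]. Qed.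

Lemma smooth_strip_Du_iter (a b : R) (f : R -> R -> R) (j : nat) :
  smooth_strip a b f -> smooth_strip a b (Nat.iter j Du f).
Proof. intros H; induction j as [|j IH]; [exact H | now apply smooth_strip_Du]. Qed.

Lemma smooth_strip_locally_bounded (a b : R) (f : R -> R -> R) (t0 x0 : R) :
  smooth_strip a b f -> Icc a b t0 ->
  exists del M, 0 < del /\ forall t x, Icc a b t ->
    Rabs (t - t0) <= del -> Rabs (x - x0) <= del -> Rabs (f t x) <= M.
Proof.
intros Hf Ht0; destruct (Hf 0%nat) as [Hc _].
destruct (Hc (t0, x0) Ht0 (fun z => Rabs z <= Rabs (f t0 x0) + 1)) as [del Hdel].
- exists (mkposreal 1 Rlt_0_1); intros z Hz.
  assert (H : Rabs (z - f t0 x0) < 1) by exact Hz.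
  replace z with (z - f t0 x0 + f t0 x0) by ring.
  eapply Rle_trans; [apply Rabs_triang | lra].
- assert (Hd := cond_pos del).
  (* Halving the radius fits a closed box inside the open ball given by continuity. *)
  exists (del / 2), (Rabs (f t0 x0) + 1); split; [lra|].
  intros t x Ht H1 H2; apply (Hdel (t, x)); [| exact Ht].
  split; [change (Rabs (t - t0) < del) | change (Rabs (x - x0) < del)]; lra.
Qed.

(** Here t0 is fixed and u is unrestricted, so ordinary derivatives are read as derivatives relative
    to [x0 - del, x0 + del] in order to apply [taylor_in]. *)
Lemma taylor_strip_u (a b : R) (f : R -> R -> R) (t0 x0 : R) (n : nat) :
  smooth_strip a b f -> Icc a b t0 ->
  exists M del, 0 < del /\ forall x, Rabs (x - x0) <= del ->
    Rabs (f t0 x -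
      polynomial (fun j => Nat.iter j Du f t0 x0 / INR (fact j)) n (x - x0))
    <= M * Rabs (x - x0) ^ n.
Proof.
intros Hf Ht0.
destruct (smooth_strip_locally_bounded a b (Nat.iter n Du f) t0 x0)
  as (del & M & Hdel & HM); [now apply smooth_strip_Du_iter | exact Ht0 |].
exists M, del; split; [exact Hdel|]; intros x Hx.
assert (Hball : forall y, Icc (x0 - del) (x0 + del) y <-> Rabs (y - x0) <= del).
{ intros y; rewrite Rabs_le_between; unfold Icc; lra. }
apply (taylor_in (x0 - del) (x0 + del) x0 M n (fun j y => Nat.iter j Du f t0 y)).
- unfold Icc; lra.
- intros k y _ Hy; apply is_derive_is_derive_in; [exact Hy|].
  simpl; apply Derive_correct.
  destruct (smooth_strip_Du_iter a b f k Hf 1%nat) as [_ [H _]].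
  exact (proj2 (H t0 y Ht0)).
- intros y Hy; apply HM; [exact Ht0 | | now apply Hball].
  replace (t0 - t0) with 0 by ring; rewrite Rabs_R0; lra.
- now apply Hball.
Qed.

(** The bound is uniform in x near x0 because the second argument will be u0 + h g(h), which moves
    with h. *)
Lemma taylor_strip_t (a b : R) (f : R -> R -> R) (t0 x0 : R) (n : nat) :
  smooth_strip a b f -> a <= t0 < b ->
  exists M del, 0 < del /\ forall s x, 0 <= s <= del -> Rabs (x - x0) <= del ->
    Rabs (f (t0 + s) x -
      polynomial (fun i => Nat.iter i (Dt a b) f t0 x / INR (fact i)) n s)
    <= M * s ^ n.
Proof.
intros Hf Ht0.
destruct (smooth_strip_locally_bounded a b (Nat.iter n (Dt a b) f) t0 x0)
  as (del' & M & Hdel' & HM);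
  [now apply smooth_strip_Dt_iter | unfold Icc; lra |].
(* The second bound keeps t0 + s inside [a,b]; it is positive because t0 < b. *)
set (del := Rmin del' (b - t0)).
assert (Hdel : 0 < del /\ del <= del' /\ t0 + del <= b).
{ unfold del, Rmin; destruct (Rle_dec _ _); lra. }
exists M, del; split; [lra|]; intros s x Hs Hx.
assert (H : Rabs (f (t0 + s) x -
      polynomial (fun i => Nat.iter i (Dt a b) f t0 x / INR (fact i)) n (t0 + s - t0))
    <= M * Rabs (t0 + s - t0) ^ n).
{ apply (taylor_in t0 (t0 + del) t0 M n (fun i t => Nat.iter i (Dt a b) f t x)).
  - unfold Icc; lra.
  - intros k t _ Ht.
    assert (Ht' : Icc a b t) by (unfold Icc in *; lra).
    apply (is_derive_in_subset a b); [lra | lra | exact Ht |].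
    apply Derive_in_correct; [lra | exact Ht' |].
    destruct (smooth_strip_Dt_iter a b f k Hf 1%nat) as [_ [H _]].
    exact (proj1 (H t x Ht')).
  - intros t Ht; apply HM; unfold Icc in *; [lra | rewrite Rabs_pos_eq; lra | lra].
  - unfold Icc; lra. }
replace (t0 + s - t0) with s in H by ring.
rewrite (Rabs_pos_eq s) in H by lra; exact H.
Qed.

(* Coefficients of [h |-> f (t0 + c h) (u0 + h g(h))] when [g] has coefficients
   [y] and [d i j] are the partial derivatives of [f] at [(t0, u0)]. *)
Definition comp_coeff (d : nat -> nat -> R) (c : R) (y : nat -> R) (k : nat) : R :=
  sum_f_R0 (fun i => c ^ i / INR (fact i) *
    sum_f_R0 (fun j => d i j / INR (fact j) * PS_power y j (k - i - j)) (k - i)) k.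

(** [taylor_strip_t] expands in t while the second argument moves; each resulting coefficient is a
    function of u at fixed t0, which [expands_comp] expands. The sign of c keeps t0 + c h to the
    right of t0, where the Taylor bound holds. *)
Lemma expands_strip (a b : R) (f : R -> R -> R) (t0 u0 c : R) (n : nat)
    (g : R -> R) (y : nat -> R) :
  smooth_strip a b f -> a <= t0 < b -> 0 <= c ->
  expands n g y ->
  expands n (fun h => f (t0 + c * h) (u0 + h * g h))
    (comp_coeff (fun i j => pd a b f i j t0 u0) c y).
Proof.
intros Hf Ht0 Hc Hg.
assert (Ht : Icc a b t0) by (unfold Icc; lra).
assert (H1 : expands n
  (fun h => sum_lt (fun i => h ^ i *
     (c ^ i / INR (fact i) * Nat.iter i (Dt a b) f t0 (u0 + h * g h))) n)
  (comp_coeff (fun i j => pd a b f i j t0 u0) c y)).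
{ apply (expands_sum_shifted n
    (fun i h => c ^ i / INR (fact i) * Nat.iter i (Dt a b) f t0 (u0 + h * g h))
    (fun i m => c ^ i / INR (fact i) *
       sum_f_R0 (fun j => pd a b f i j t0 u0 / INR (fact j) * PS_power y j (m - j)) m)).
  intros i _; apply (expands_scal n (c ^ i / INR (fact i))).
  destruct (taylor_strip_u a b (Nat.iter i (Dt a b) f) t0 u0 n) as (M & del & Hd & H);
    [now apply smooth_strip_Dt_iter | exact Ht |].
  now apply (expands_comp n (Nat.iter i (Dt a b) f t0) g _ y u0 M del). }
destruct (taylor_strip_t a b f t0 u0 n Hf Ht0) as (M & del & Hd & H).
destruct (expands_bounded _ _ _ Hg) as (B & HB0 & HB).
assert (H2 : bigO_pow_right (fun h => f (t0 + c * h) (u0 + h * g h) -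
   sum_lt (fun i => h ^ i *
     (c ^ i / INR (fact i) * Nat.iter i (Dt a b) f t0 (u0 + h * g h))) n) n).
{ exists (M * c ^ n).
  (* One bound on h makes both c h and |h g(h)| at most [del]. *)
  assert (Hr : 0 < del / (B + c + 1)) by (apply Rdiv_lt_0_compat; lra).
  generalize (filter_and _ _ HB (at_right_0_lt _ Hr)); apply filter_imp.
  intros h (Hh & Hh0 & Hh1).
  apply (Rmult_lt_compat_r (B + c + 1)) in Hh1; [|lra].
  replace (del / (B + c + 1) * (B + c + 1)) with del in Hh1 by (field; lra).
  assert (Hv : Rabs (h * g h) <= h * B).
  { rewrite Rabs_mult, (Rabs_pos_eq h) by lra; apply Rmult_le_compat_l; lra. }
  specialize (H (c * h) (u0 + h * g h)).
  replace (u0 + h * g h - u0) with (h * g h) in H by ring.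
  replace (M * c ^ n * h ^ n) with (M * (c * h) ^ n)
    by (rewrite Rpow_mult_distr; ring).
  replace (sum_lt _ n) with
    (polynomial (fun i => Nat.iter i (Dt a b) f t0 (u0 + h * g h) / INR (fact i))
       n (c * h)).
  2:{ apply sum_lt_ext; intros i _; rewrite Rpow_mult_distr; unfold Rdiv; ring. }
  apply H; [|nra].
  assert (0 <= c * h) by (apply Rmult_le_pos; lra).
  assert (0 <= h * B) by (apply Rmult_le_pos; lra).
  lra. }
generalize (bigO_plus _ _ _ H2 H1); apply bigO_ext_near, filter_forall.
intros h; ring.
Qed.

Lemma Derive_in_n_correct (a b : R) (u : R -> R) (k : nat) (t : R) :
  a < b -> smooth_in a b u -> Icc a b t ->
  is_derive_in a b (Derive_in_n a b k u) t (Derive_in_n a b (S k) u t).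
Proof. intros Hab Hu Ht; now apply Derive_in_correct, Hu. Qed.

(** Used with m = 0 for u and m = 1 for u'. The remainder is controlled because the derivative of
    order n + m is itself differentiable, hence continuous and bounded near t0. *)
Lemma expands_smooth_in (a b : R) (u : R -> R) (t0 : R) (m n : nat) :
  a <= t0 < b -> smooth_in a b u ->
  expands n (fun h => Derive_in_n a b m u (t0 + h))
    (fun k => Derive_in_n a b (k + m) u t0 / INR (fact k)).
Proof.
intros Ht0 Hu.
assert (Hlim : filterlim (Derive_in_n a b (n + m) u)
   (within (Icc a b) (locally t0)) (locally (Derive_in_n a b (n + m) u t0))).
{ apply is_derive_in_filterlim; [unfold Icc; lra|].
  apply Hu; unfold Icc; lra. }
set (M := Rabs (Derive_in_n a b (n + m) u t0) + 1).
destruct (Hlim (fun z => Rabs z <= M)) as [del' Hdel'].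
{ exists (mkposreal 1 Rlt_0_1); intros z Hz.
  assert (H : Rabs (z - Derive_in_n a b (n + m) u t0) < 1) by exact Hz.
  replace z with (z - Derive_in_n a b (n + m) u t0 + Derive_in_n a b (n + m) u t0)
    by ring.
  eapply Rle_trans; [apply Rabs_triang | unfold M; lra]. }
assert (Hd' := cond_pos del').
set (del := Rmin (del' / 2) (b - t0)).
assert (Hdel : 0 < del /\ del < del' /\ t0 + del <= b).
{ unfold del, Rmin; destruct (Rle_dec _ _); lra. }
apply (expands_of_taylor n _ _ M del); [lra|]; intros h Hh.
replace h with (t0 + h - t0) at 2 3 by ring.
apply (taylor_in t0 (t0 + del) t0 M n (fun k => Derive_in_n a b (k + m) u)).
- unfold Icc; lra.
- intros k t _ Ht; apply (is_derive_in_subset a b); [lra | lra | exact Ht |].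
  apply Derive_in_n_correct; unfold Icc in *; [lra | exact Hu | lra].
- intros t Ht; apply Hdel'; [| unfold Icc in *; lra].
  change (Rabs (t - t0) < del'); unfold Icc in Ht; rewrite Rabs_pos_eq; lra.
- unfold Icc; lra.
Qed.

(** * The Runge-Kutta stages *)

(** Besides being the first term of the truncation error, this quotient q puts the solution in the
    form u(t0 + h) = u0 + h q(h) that [expands_strip] accepts. *)
Lemma solution_quotient_expands (a b : R) (u : R -> R) (t0 : R) (n : nat) :
  a <= t0 < b -> smooth_in a b u ->
  expands n (fun h => (u (t0 + h) - u t0) / h)
    (fun k => Derive_in_n a b (S k) u t0 / INR (fact (S k))).
Proof.
intros Ht0 Hu.
assert (H := expands_smooth_in a b u t0 0 (S n) Ht0 Hu).
apply expands_S in H.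
apply expands_ext_coeff with (c' := fun k => Derive_in_n a b (S k) u t0 / INR (fact (S k)))
  in H; [| intros k _; now rewrite Nat.add_0_r].
revert H; apply expands_ext; intros h; simpl; unfold Rdiv; now rewrite Rinv_1, Rmult_1_r.
Qed.

(** Both sides are coefficients of u'(t0 + h) = f(t0 + h, u(t0 + h)): the left through the
    derivatives of u, the right by substituting u0 + h q(h) into f. At index k the right side
    involves only q 0, ..., q (k - 1), so this is a recursion. *)
Lemma solution_coeff (a b : R) (f : R -> R -> R) (u : R -> R) (t0 : R) :
  a <= t0 < b -> smooth_strip a b f -> smooth_in a b u ->
  (forall t, Icc a b t -> is_derive_in a b u t (f t (u t))) ->
  let q := fun k => Derive_in_n a b (S k) u t0 / INR (fact (S k)) in
  forall k, INR (S k) * q k = comp_coeff (fun i j => pd a b f i j t0 (u t0)) 1 q k.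
Proof.
intros Ht0 Hf Hu Hode q k.
(* Order k + 1 is the least that determines the coefficient of index k. *)
apply (expands_unique (S k) (fun h => f (t0 + h) (u (t0 + h)))
  (fun k => INR (S k) * q k)); [| | lia].
- assert (H := expands_smooth_in a b u t0 1 (S k) Ht0 Hu).
  apply expands_ext_coeff with (c' := fun k => INR (S k) * q k) in H.
  + revert H; apply expands_ext_near.
    assert (Hb : 0 < b - t0) by lra.
    generalize (at_right_0_lt _ Hb); apply filter_imp; intros h Hh.
    assert (Ht : Icc a b (t0 + h)) by (unfold Icc; lra).
    apply (is_derive_in_unique a b u (t0 + h)); [lra | exact Ht | | now apply Hode].
    apply (Derive_in_n_correct a b u 0); [lra | exact Hu | exact Ht].
  + intros j _; unfold q; rewrite Nat.add_1_r, fact_simpl, mult_INR.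
    assert (H1 := INR_fact_neq_0 j); assert (H2 : INR (S j) <> 0) by now apply not_0_INR.
    field; easy.
- assert (H := expands_strip a b f t0 (u t0) 1 (S k) _ q Hf Ht0 Rle_0_1
    (solution_quotient_expands a b u t0 (S k) Ht0 Hu)).
  revert H; apply expands_ext_near.
  generalize (at_right_0_lt _ Rlt_0_1); apply filter_imp; intros h Hh.
  f_equal; [ring | field; lra].
Qed.

(* The argument of [K_j] is [u0 + h g(h)] with [g = s + h kap (u0 + h s)] and
   [kap = e c^2 / 2], where [s] is the weighted sum of the earlier stages. *)
Definition stage_coeff (e c u0 : R) (s : nat -> R) (k : nat) : R :=
  s k + match k with
        | O => 0
        | S O => e * c ^ 2 / 2 * u0
        | S (S k) => e * c ^ 2 / 2 * s k
        end.

Lemma expands_stage (a b : R) (f : R -> R -> R) (t0 u0 e c : R) (n : nat)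
    (S0 : R -> R) (s : nat -> R) :
  smooth_strip a b f -> a <= t0 < b -> 0 <= c ->
  expands n S0 s ->
  expands n (fun h => f (t0 + c * h) (mq_factor e (c * h) * (u0 + h * S0 h)))
    (comp_coeff (fun i j => pd a b f i j t0 u0) c (stage_coeff e c u0 s)).
Proof.
intros Hf Ht0 Hc Hs.
set (kap := e * c ^ 2 / 2).
apply expands_ext with
  (fun h => f (t0 + c * h) (u0 + h * (S0 h + h * (kap * (u0 + h * S0 h))))).
{ intros h; f_equal; unfold mq_factor, kap; field. }
apply (expands_strip a b f t0 u0 c n (fun h => S0 h + h * (kap * (u0 + h * S0 h))));
  [exact Hf | exact Ht0 | exact Hc |].
assert (H1 := expands_shift _ _ _ Hs).
assert (H2 := expands_plus _ _ _ _ _ (expands_const (S n) u0) H1).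
assert (H3 := expands_shift _ _ _ (expands_scal _ kap _ _ H2)).
(* Two multiplications by h have raised the order to n + 2, but [S0] itself is known only to order
   n. *)
assert (H4 := expands_plus _ _ _ _ _ Hs (expands_le n (S (S n)) _ _ ltac:(lia) H3)).
revert H4; apply expands_ext_coeff; intros k _; unfold stage_coeff; fold kap.
destruct k as [|[|k]]; ring.
Qed.

Definition K1_coeff (d : nat -> nat -> R) (k : nat) : R :=
  match k with O => d 0%nat 0%nat | S _ => 0 end.

Definition K2_coeff (M : rk4_coeffs) (d : nat -> nat -> R) (u0 e2 : R) : nat -> R :=
  comp_coeff d (c2 M) (stage_coeff e2 (c2 M) u0 (fun k => a21 M * K1_coeff d k)).

Definition K3_coeff (M : rk4_coeffs) (d : nat -> nat -> R) (u0 e2 e3 : R) : nat -> R :=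
  comp_coeff d (c3 M) (stage_coeff e3 (c3 M) u0
    (fun k => a31 M * K1_coeff d k + a32 M * K2_coeff M d u0 e2 k)).

Definition K4_coeff (M : rk4_coeffs) (d : nat -> nat -> R) (u0 e2 e3 e4 : R) : nat -> R :=
  comp_coeff d (c4 M) (stage_coeff e4 (c4 M) u0
    (fun k => a41 M * K1_coeff d k + a42 M * K2_coeff M d u0 e2 k
              + a43 M * K3_coeff M d u0 e2 e3 k)).

Definition increment_coeff (M : rk4_coeffs) (d : nat -> nat -> R) (u0 e2 e3 e4 : R)
    (k : nat) : R :=
  w1 M * K1_coeff d k + w2 M * K2_coeff M d u0 e2 k
  + w3 M * K3_coeff M d u0 e2 e3 k + w4 M * K4_coeff M d u0 e2 e3 e4 k.

Lemma expands_increment (a b : R) (f : R -> R -> R) (t0 u0 e2 e3 e4 : R)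
    (M : rk4_coeffs) (n : nat) :
  smooth_strip a b f -> a <= t0 < b -> 0 <= c2 M -> 0 <= c3 M -> 0 <= c4 M ->
  expands n (fun h => mq_rk4_increment M f e2 e3 e4 t0 u0 h)
    (increment_coeff M (fun i j => pd a b f i j t0 u0) u0 e2 e3 e4).
Proof.
intros Hf Ht0 H2 H3 H4; unfold mq_rk4_increment, increment_coeff.
set (d := fun i j => pd a b f i j t0 u0).
assert (E1 : expands n (fun _ => f t0 u0) (K1_coeff d)) by apply expands_const.
assert (E2 : expands n (fun h => f (t0 + c2 M * h)
    (mq_factor e2 (c2 M * h) * (u0 + h * (a21 M * f t0 u0)))) (K2_coeff M d u0 e2)).
{ apply (expands_stage a b f t0 u0 e2 (c2 M) n (fun _ => a21 M * f t0 u0)); auto.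
  now apply (expands_scal n (a21 M) (fun _ => f t0 u0)). }
(* Reassociates h a21 K1 to match the bracketing in [mq_rk4_increment]. *)
apply (expands_ext _ _ (fun h => f (t0 + c2 M * h)
    (mq_factor e2 (c2 M * h) * (u0 + h * a21 M * f t0 u0)))) in E2;
  [| intros h; do 3 f_equal; ring].
set (K2 := fun h => f (t0 + c2 M * h)
    (mq_factor e2 (c2 M * h) * (u0 + h * a21 M * f t0 u0))) in *.
assert (E3 : expands n (fun h => f (t0 + c3 M * h)
    (mq_factor e3 (c3 M * h) * (u0 + h * (a31 M * f t0 u0 + a32 M * K2 h))))
    (K3_coeff M d u0 e2 e3)).
{ apply (expands_stage a b f t0 u0 e3 (c3 M) n
    (fun h => a31 M * f t0 u0 + a32 M * K2 h)); auto.
  apply (expands_plus n (fun _ => a31 M * f t0 u0) (fun h => a32 M * K2 h)).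
  - now apply (expands_scal n (a31 M) (fun _ => f t0 u0)).
  - now apply expands_scal. }
set (K3 := fun h => f (t0 + c3 M * h)
    (mq_factor e3 (c3 M * h) * (u0 + h * (a31 M * f t0 u0 + a32 M * K2 h)))) in *.
assert (E4 : expands n (fun h => f (t0 + c4 M * h)
    (mq_factor e4 (c4 M * h) *
      (u0 + h * (a41 M * f t0 u0 + a42 M * K2 h + a43 M * K3 h))))
    (K4_coeff M d u0 e2 e3 e4)).
{ apply (expands_stage a b f t0 u0 e4 (c4 M) n
    (fun h => a41 M * f t0 u0 + a42 M * K2 h + a43 M * K3 h)); auto.
  apply (expands_plus n (fun h => a41 M * f t0 u0 + a42 M * K2 h) (fun h => a43 M * K3 h)).
  - apply (expands_plus n (fun _ => a41 M * f t0 u0) (fun h => a42 M * K2 h)).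
    + now apply (expands_scal n (a41 M) (fun _ => f t0 u0)).
    + now apply expands_scal.
  - now apply expands_scal. }
assert (S1 := expands_scal n (w1 M) _ _ E1).
assert (S2 := expands_scal n (w2 M) _ _ E2).
assert (S3 := expands_scal n (w3 M) _ _ E3).
assert (S4 := expands_scal n (w4 M) _ _ E4).
exact (expands_plus _ _ _ _ _ (expands_plus _ _ _ _ _ (expands_plus _ _ _ _ _ S1 S2) S3) S4).
Qed.

Lemma bigO_of_expands (n m : nat) (g : R -> R) (c : nat -> R) :
  (n <= m)%nat -> expands m g c -> (forall k, (k < n)%nat -> c k = 0) ->
  bigO_pow_right g n.
Proof.
intros Hnm H Hc; apply (expands_le n m) in H; [| exact Hnm].
revert H; apply bigO_ext_near, filter_forall; intros h.
replace (polynomial c n h) with 0; [ring|].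
unfold polynomial; revert Hc; clear; induction n as [|n IH]; intros Hc; simpl; [easy|].
rewrite <- IH, Hc; [ring | lia | intros; apply Hc; lia].
Qed.

(** * Closed forms of the coefficients up to h^4 *)

Lemma comp_coeff_0 (d : nat -> nat -> R) (c : R) (y : nat -> R) :
  comp_coeff d c y 0 = d 0%nat 0%nat.
Proof. unfold comp_coeff, PS_power, PS_mult; simpl; field. Qed.

Lemma comp_coeff_1 (d : nat -> nat -> R) (c : R) (y : nat -> R) :
  comp_coeff d c y 1 = d 1%nat 0%nat * c + d 0%nat 1%nat * y 0%nat.
Proof. unfold comp_coeff, PS_power, PS_mult; simpl; field. Qed.

Lemma comp_coeff_2 (d : nat -> nat -> R) (c : R) (y : nat -> R) :
  comp_coeff d c y 2 = d 2%nat 0%nat * c ^ 2 / 2 + d 1%nat 1%nat * c * y 0%nat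
    + d 0%nat 2%nat * y 0%nat ^ 2 / 2 + d 0%nat 1%nat * y 1%nat.
Proof. unfold comp_coeff, PS_power, PS_mult; simpl; field. Qed.

Lemma comp_coeff_3 (d : nat -> nat -> R) (c : R) (y : nat -> R) :
  comp_coeff d c y 3 = d 3%nat 0%nat * c ^ 3 / 6 + d 2%nat 1%nat * c ^ 2 / 2 * y 0%nat
    + d 1%nat 2%nat * c * y 0%nat ^ 2 / 2 + d 0%nat 3%nat * y 0%nat ^ 3 / 6
    + d 1%nat 1%nat * c * y 1%nat + d 0%nat 2%nat * y 0%nat * y 1%nat
    + d 0%nat 1%nat * y 2%nat.
Proof. unfold comp_coeff, PS_power, PS_mult; simpl; field. Qed.

Lemma comp_coeff_4 (d : nat -> nat -> R) (c : R) (y : nat -> R) :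
  comp_coeff d c y 4 = d 4%nat 0%nat * c ^ 4 / 24 + d 3%nat 1%nat * c ^ 3 / 6 * y 0%nat
    + d 2%nat 2%nat * c ^ 2 * y 0%nat ^ 2 / 4 + d 1%nat 3%nat * c * y 0%nat ^ 3 / 6
    + d 0%nat 4%nat * y 0%nat ^ 4 / 24
    + d 2%nat 1%nat * c ^ 2 / 2 * y 1%nat + d 1%nat 2%nat * c * y 0%nat * y 1%nat
    + d 0%nat 3%nat * y 0%nat ^ 2 * y 1%nat / 2 + d 0%nat 2%nat * y 1%nat ^ 2 / 2
    + d 1%nat 1%nat * c * y 2%nat + d 0%nat 2%nat * y 0%nat * y 2%nat
    + d 0%nat 1%nat * y 3%nat.
Proof. unfold comp_coeff, PS_power, PS_mult; simpl; field. Qed.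

(** The right-hand sides stay folded: opening one brings in only smaller indices of q, which are
    then replaced in turn. *)
Lemma solution_coeff_values (d : nat -> nat -> R) (q : nat -> R) :
  (forall k, INR (S k) * q k = comp_coeff d 1 q k) ->
  q 0%nat = d 0%nat 0%nat /\
  q 1%nat = comp_coeff d 1 q 1 / 2 /\
  q 2%nat = comp_coeff d 1 q 2 / 3 /\
  q 3%nat = comp_coeff d 1 q 3 / 4 /\
  q 4%nat = comp_coeff d 1 q 4 / 5.
Proof.
intros Hq; rewrite <- !Hq; simpl; repeat split; try field.
assert (H := Hq 0%nat); rewrite comp_coeff_0 in H; simpl in H; lra.
Qed.

(** Rewriting runs down the indices, since each expansion produces only smaller ones; the repeated
    passes reach the earlier stages nested inside the later ones. *)
Ltac expand_error Hq :=
  destruct (solution_coeff_values _ _ Hq) as (Q0 & Q1 & Q2 & Q3 & Q4);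
  unfold increment_coeff, K4_coeff, K3_coeff, K2_coeff;
  rewrite ?Q4, ?comp_coeff_4, ?Q3, ?comp_coeff_3, ?Q2, ?comp_coeff_2,
    ?Q1, ?comp_coeff_1, ?Q0, ?comp_coeff_0;
  unfold stage_coeff, K1_coeff;
  rewrite ?comp_coeff_4, ?comp_coeff_3, ?comp_coeff_2, ?comp_coeff_1, ?comp_coeff_0;
  rewrite ?comp_coeff_4, ?comp_coeff_3, ?comp_coeff_2, ?comp_coeff_1, ?comp_coeff_0;
  cbn [c2 c3 c4 a21 a31 a32 a41 a42 a43 w1 w2 w3 w4 tableau_C1 tableau_C2].

(** The ties between the shape parameters cancel the multiquadric terms. At h^2, for instance, these
    add up to f_u u_i / 2 times the sum of w_j e_j c_j^2, which is x (4 - 6 + 2) / 72 = 0. *)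
Lemma error_coeff_C1_lt_4 (d : nat -> nat -> R) (q : nat -> R) (u0 x : R) (k : nat) :
  (forall k, INR (S k) * q k = comp_coeff d 1 q k) -> (k < 4)%nat ->
  q k - increment_coeff tableau_C1 d u0 x (- (2/3) * x) (2/11 * x) k = 0.
Proof.
intros Hq Hk.
destruct k as [|[|[|[|k]]]]; [| | | | lia]; expand_error Hq; field.
Qed.

Lemma error_coeff_C2_lt_4 (d : nat -> nat -> R) (q : nat -> R) (u0 x : R) (k : nat) :
  (forall k, INR (S k) * q k = comp_coeff d 1 q k) -> (k < 4)%nat ->
  q k - increment_coeff tableau_C2 d u0 x (- (1/6) * x) (1/10 * x) k = 0.
Proof.
intros Hq Hk.
destruct k as [|[|[|[|k]]]]; [| | | | lia]; expand_error Hq; field.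
Qed.

(** For the solution, q 1 = u''(t_i) / 2, so [2 * q 1%nat] takes the place of u''(t_i) in the
    quadratic. *)
Lemma error_coeff_C1_4 (d : nat -> nat -> R) (q : nat -> R) (u0 x : R) :
  (forall k, INR (S k) * q k = comp_coeff d 1 q k) ->
  q 4%nat - increment_coeff tableau_C1 d u0 x (- (2/3) * x) (2/11 * x) 4
  = - quadratic_C1 d u0 (2 * q 1%nat) x / 39600.
Proof.
intros Hq; unfold quadratic_C1; cbv zeta.
expand_error Hq; field.
Qed.

Lemma error_coeff_C2_4 (d : nat -> nat -> R) (q : nat -> R) (u0 x : R) :
  (forall k, INR (S k) * q k = comp_coeff d 1 q k) ->
  q 4%nat - increment_coeff tableau_C2 d u0 x (- (1/6) * x) (1/10 * x) 4
  = - quadratic_C2 d u0 (2 * q 1%nat) x / 5760.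
Proof.
intros Hq; unfold quadratic_C2; cbv zeta.
expand_error Hq; field.
Qed.

(** * Orders of the truncation errors *)

Lemma expands_truncation_error (a b : R) (f : R -> R -> R) (u : R -> R) (t0 : R)
    (M : rk4_coeffs) (e2 e3 e4 : R) (n : nat) :
  a <= t0 < b -> smooth_strip a b f -> smooth_in a b u ->
  0 <= c2 M -> 0 <= c3 M -> 0 <= c4 M ->
  expands n (truncation_error M f u e2 e3 e4 t0)
    (fun k => Derive_in_n a b (S k) u t0 / INR (fact (S k))
       - increment_coeff M (fun i j => pd a b f i j t0 (u t0)) (u t0) e2 e3 e4 k).
Proof.
intros Ht0 Hf Hu H2 H3 H4.
assert (E1 := solution_quotient_expands a b u t0 n Ht0 Hu).
assert (E2 := expands_increment a b f t0 (u t0) e2 e3 e4 M n Hf Ht0 H2 H3 H4).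
apply (expands_scal n (-1)) in E2.
generalize (expands_plus _ _ _ _ _ E1 E2); intros E.
apply expands_ext with (g' := truncation_error M f u e2 e3 e4 t0) in E;
  [| intros h; unfold truncation_error; ring].
revert E; apply expands_ext_coeff; intros k _; ring.
Qed.

Theorem mainTheorem3 :
  forall (a b : R) (f : R -> R -> R) (u : R -> R) (ti : R),
    a <= ti < b ->
    smooth_strip a b f ->
    smooth_in a b u ->
    (forall t, Icc a b t -> is_derive_in a b u t (f t (u t))) ->
    let d := fun i j : nat => pd a b f i j ti (u ti) in
    let ui2 := Derive_in_n a b 2 u ti in
    ((forall x : R, quadratic_C1 d (u ti) ui2 x = 0 ->
        bigO_pow_right
          (truncation_error tableau_C1 f u x (- (2/3) * x) (2/11 * x) ti) 5) /\
     (forall x : R,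
        bigO_pow_right
          (truncation_error tableau_C1 f u x (- (2/3) * x) (2/11 * x) ti) 4)) /\
    ((forall x : R, quadratic_C2 d (u ti) ui2 x = 0 ->
        bigO_pow_right
          (truncation_error tableau_C2 f u x (- (1/6) * x) (1/10 * x) ti) 5) /\
     (forall x : R,
        bigO_pow_right
          (truncation_error tableau_C2 f u x (- (1/6) * x) (1/10 * x) ti) 4)).
Proof.
intros a b f u ti Hti Hf Hu Hode d ui2.
set (q := fun k => Derive_in_n a b (S k) u ti / INR (fact (S k))).
assert (Hq : forall k, INR (S k) * q k = comp_coeff d 1 q k)
  by exact (solution_coeff a b f u ti Hti Hf Hu Hode).
assert (Hui2 : ui2 = 2 * q 1%nat) by (unfold q, ui2; simpl; field).
assert (E1 : forall x, expands 5
    (truncation_error tableau_C1 f u x (- (2/3) * x) (2/11 * x) ti)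
    (fun k => q k - increment_coeff tableau_C1 d (u ti) x (- (2/3) * x) (2/11 * x) k))
  by (intros x; apply expands_truncation_error; simpl; auto; lra).
assert (E2 : forall x, expands 5
    (truncation_error tableau_C2 f u x (- (1/6) * x) (1/10 * x) ti)
    (fun k => q k - increment_coeff tableau_C2 d (u ti) x (- (1/6) * x) (1/10 * x) k))
  by (intros x; apply expands_truncation_error; simpl; auto; lra).
rewrite Hui2; repeat split; intros x; [intros Hx | | intros Hx |].
- apply (bigO_of_expands 5 5 _ _ (le_n 5) (E1 x)); intros k Hk.
  (* Only index 4 calls on the quadratic equation; the lower coefficients vanish for every x. *)
  destruct (Nat.eq_dec k 4) as [-> | Hk4];
    [rewrite error_coeff_C1_4, Hx by exact Hq; field |
     apply error_coeff_C1_lt_4; [exact Hq | lia]].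
(* Fourth order stops short of index 4, so nothing is asked of x. *)
- apply (bigO_of_expands 4 5 _ _ (le_S _ _ (le_n 4)) (E1 x)); intros k Hk.
  now apply error_coeff_C1_lt_4.
- apply (bigO_of_expands 5 5 _ _ (le_n 5) (E2 x)); intros k Hk.
  destruct (Nat.eq_dec k 4) as [-> | Hk4];
    [rewrite error_coeff_C2_4, Hx by exact Hq; field |
     apply error_coeff_C2_lt_4; [exact Hq | lia]].
- apply (bigO_of_expands 4 5 _ _ (le_S _ _ (le_n 4)) (E2 x)); intros k Hk.
  now apply error_coeff_C2_lt_4.
Qed.
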